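(* Let $k\ge1$, let $\boldsymbol{\omega}=(\omega_1,\ldots,\omega_k)$ and $\boldsymbol{\delta}=(\delta_1,\ldots,\delta_k)$ be vectors of nonnegative integers, fix $i\in\{1,\ldots,k\}$ and assume that $\omega_i=1$. Let $n_1,\ldots,n_k$ be positive integers with $n_i-1=\sum_{j\neq i}(n_j-1)+\delta_i$. Then \[ d\big((n_1,\ldots,n_{i-1},m,n_{i+1},\ldots,n_k),\boldsymbol{\delta},\boldsymbol{\omega}\big)=d\big((n_1,\ldots,n_{i-1},n_i,n_{i+1},\ldots,n_k),\boldsymbol{\delta},\boldsymbol{\omega}\big)\qquad\forall\,m\geq n_i . \]
   Context: For $\mathbf{n}=(n_1,\ldots,n_k)$ a vector of positive integers and $\delta=\sum_{i}\delta_i$, $d(\mathbf{n},\boldsymbol{\delta},\boldsymbol{\omega})$ denotes the coefficient of the monomial $h^{\delta}\prod_{i=1}^kt_i^{n_i-\delta_i-1}$ (understood to be $0$ if some exponent is negative) in the polynomial \[ \prod_{i=1}^{k}\frac{(\widehat{t_i}+h)^{n_i}-t_i^{n_i}}{(\widehat{t_i}+h)-t_i},\qquad \widehat{t_i}:=\Big(\sum_{j=1}^{k}\omega_j t_j\Big)-t_i . \] *)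

(* Defs.v *)
From HB Require Import structures.
From mathcomp Require Import all_boot all_order all_algebra.
From mathcomp Require Import mpoly.

Set Implicit Arguments.
Unset Strict Implicit.
Unset Printing Implicit Defensive.

Import GRing.Theory.
Local Open Scope ring_scope.

(* Z[t_1, ..., t_k][h] is represented as {poly {mpoly int[k]}}: the t_j are the
   variables of the coefficient ring and h is the univariate indeterminate 'X. *)
Section CoefficientD.
Variable k : nat.
Implicit Types (n delta omega : 'I_k -> nat) (i : 'I_k).

Definition tvar i : {poly {mpoly int[k]}} := ('X_i)%:P.

Definition hvar : {poly {mpoly int[k]}} := 'X.

Definition that omega i : {poly {mpoly int[k]}} :=
  (\sum_(j < k) tvar j *+ omega j) - tvar i.

(* %/ is division of polynomials in h; the divisor is monic in h, and the
   division is exact (dfactorE below). *)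
Definition dfactor omega i (ni : nat) : {poly {mpoly int[k]}} :=
  ((that omega i + hvar) ^+ ni - tvar i ^+ ni)
    %/ ((that omega i + hvar) - tvar i).

Definition dpoly n omega : {poly {mpoly int[k]}} :=
  \prod_(i < k) dfactor omega i (n i).

(* The truncated subtractions in the monomial are genuine in the first branch. *)
Definition d n delta omega : int :=
  if [forall j, (delta j < n j)%N] then
    ((dpoly n omega)`_(\sum_(j < k) delta j)%N)
      @_[multinom (n j - delta j - 1)%N | j < k]
  else 0.

Lemma dfactor_divisor_monic omega i :
  (that omega i + hvar) - tvar i \is monic.
Proof.
have -> : that omega i = ((\sum_(j < k) 'X_j *+ omega j) - 'X_i)%:P.
  rewrite /that /tvar polyCB rmorph_sum /=.
  by under [in RHS]eq_bigr do rewrite polyCMn.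
rewrite /tvar /hvar addrAC addrC -polyCB -[X in 'X + X]opprK -polyCN.
exact: monicXsubC.
Qed.

Lemma dfactorE omega i ni :
  dfactor omega i ni * ((that omega i + hvar) - tvar i)
  = (that omega i + hvar) ^+ ni - tvar i ^+ ni.
Proof.
by rewrite /dfactor subrXX Pdiv.IdomainMonic.mulKp ?dfactor_divisor_monic 1?mulrC.
Qed.

End CoefficientD.

Definition set_coord (k : nat) (n : 'I_k -> nat) (i : 'I_k) (m : nat) :
    'I_k -> nat :=
  fun j => if j == i then m else n j.

(* Main.v *)
(** Write [s] for the [i]-th [that]; as [omega i = 1] it is free of [t_i].  The [i]-th
    factor satisfies [F (m+1) = t_i * F m + (s + h)^m], so passing from [m] to [m+1]
    changes [d] by the coefficient of a monomial with [t_i]-exponent [m - delta_i] in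
    [(s + h)^m] times the other factors.  That product has [t_i]-degree at most
    [sum_(j != i) (n_j - 1)], which is smaller than [m - delta_i] once [n_i <= m]. *)
Require Import Defs.
From mathcomp Require Import all_boot all_order all_algebra.
From mathcomp Require Import mpoly.
From mathcomp Require Import zify.

Set Implicit Arguments.
Unset Strict Implicit.
Unset Printing Implicit Defensive.

Import GRing.Theory.
Local Open Scope ring_scope.

Section DegreeBound.
Variables (k : nat) (R : nzRingType) (i : 'I_k).
Implicit Types (p q : {poly {mpoly R[k]}}) (M N : nat).

(** Vanishing coefficients stand in for an actual degree, so that zero needs no convention and sums
    stay bounded whatever cancels. Powers of [h] do not count. *)
Definition tdeg_le N p :=
  forall (a : nat) (m : 'X_{1..k}), (N < m i)%N -> (p`_a)@_m = 0.

Lemma tdeg_leW M N p : (M <= N)%N -> tdeg_le M p -> tdeg_le N p.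
Proof. by move=> leMN hp a m /(leq_ltn_trans leMN) /hp. Qed.

Lemma tdeg_le0 N : tdeg_le N 0.
Proof. by move=> a m _; rewrite coef0 mcoeff0. Qed.

Lemma tdeg_leD N p q : tdeg_le N p -> tdeg_le N q -> tdeg_le N (p + q).
Proof. by move=> hp hq a m lt; rewrite coefD mcoeffD hp ?hq ?addr0. Qed.

Lemma tdeg_leN N p : tdeg_le N p -> tdeg_le N (- p).
Proof. by move=> hp a m lt; rewrite coefN mcoeffN hp ?oppr0. Qed.

Lemma tdeg_le_sum N (I : Type) (r : seq I) (P : pred I) (F : I -> {poly {mpoly R[k]}}) :
  (forall j, P j -> tdeg_le N (F j)) -> tdeg_le N (\sum_(j <- r | P j) F j).
Proof. by move=> hF; apply: (big_ind (tdeg_le N)) => //; [exact: tdeg_le0 | exact: tdeg_leD]. Qed.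

Lemma tdeg_leMn N p c : tdeg_le N p -> tdeg_le N (p *+ c).
Proof. by move=> hp a m lt; rewrite coefMn mcoeffMn hp ?mul0rn. Qed.

Lemma tdeg_leM M N p q :
  tdeg_le M p -> tdeg_le N q -> tdeg_le (M + N) (p * q).
Proof.
move=> hp hq a m lt; rewrite coefM raddf_sum big1 //= => b _.
rewrite mcoeffM big1 // => -[m1 m2] /= /eqP em.
(* Since [m1 + m2 = m] and [M + N < m i], either [m1 i] exceeds [M] or [m2 i] exceeds [N]. *)
have [/hp -> | le1] := ltnP M (bmnm m1 i); first by rewrite mul0r.
rewrite hq ?mulr0 //.
have : m i = (bmnm m1 i + bmnm m2 i)%N by rewrite {1}em mnmDE.
by move: lt le1; lia.
Qed.

Lemma tdeg_leC (c : {mpoly R[k]}) N :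
  (forall m : 'X_{1..k}, (N < m i)%N -> c@_m = 0) -> tdeg_le N c%:P.
Proof. by move=> hc a m lt; rewrite coefC; case: eqP => _; rewrite ?mcoeff0 ?hc. Qed.

Lemma tdeg_le1 : tdeg_le 0 1.
Proof.
apply: tdeg_leC => m lt; rewrite mcoeff1; case: eqP => // em.
by rewrite em mnm0E in lt.
Qed.

Lemma tdeg_le_exp N p c : tdeg_le N p -> tdeg_le (N * c) (p ^+ c).
Proof.
move=> hp; elim: c => [|c IHc]; first by rewrite muln0; exact: tdeg_le1.
by rewrite mulnS exprS; exact: tdeg_leM.
Qed.

Lemma tdeg_le_polyX : tdeg_le 0 'X.
Proof.
move=> a m lt; rewrite coefX; case: eqP => _; last by rewrite mcoeff0.
by have := tdeg_le1 0%N lt; rewrite coefC.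
Qed.

Lemma tdeg_le_var j : tdeg_le (j == i) ('X_j)%:P.
Proof.
apply: tdeg_leC => m lt; rewrite mcoeffX; case: eqP => // em.
by move: lt; rewrite -em mnm1E ltnn.
Qed.

End DegreeBound.

Lemma tdeg_le_prod (k : nat) (R : comNzRingType) (i : 'I_k) (I : Type) (r : seq I)
    (P : pred I) (F : I -> {poly {mpoly R[k]}}) (N : I -> nat) :
  (forall j, P j -> tdeg_le i (N j) (F j)) ->
  tdeg_le i (\sum_(j <- r | P j) N j)%N (\prod_(j <- r | P j) F j).
Proof.
move=> hF; apply: (big_ind2 (fun N p => tdeg_le i N p)) => //.
- exact: tdeg_le1.
- by move=> *; exact: tdeg_leM.
Qed.

Section Factors.
Variables (k : nat).
Implicit Types (n delta omega : 'I_k -> nat) (i j : 'I_k).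

Lemma tdeg_le_that i j omega : tdeg_le i 1 (that omega j + hvar k).
Proof.
have var1 l : tdeg_le i 1 (tvar l).
  by apply: tdeg_leW _ (@tdeg_le_var _ _ i l); case: (l == i).
apply: tdeg_leD; last by apply: tdeg_leW _ (@tdeg_le_polyX _ _ i).
apply: tdeg_leD; last by apply: tdeg_leN.
by apply: tdeg_le_sum => l _; apply: tdeg_leMn.
Qed.

Lemma tdeg_le_that_self i omega :
  omega i = 1%N -> tdeg_le i 0 (that omega i + hvar k).
Proof.
move=> omi; apply: tdeg_leD; last exact: tdeg_le_polyX.
(* With [omega i = 1] the sum contains exactly one [t_i], which the subtracted [t_i] cancels. *)
rewrite /that (bigD1 i) //= omi mulr1n addrAC subrr add0r.
apply: tdeg_le_sum => l /negPf nli; apply: tdeg_leMn.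
by have := @tdeg_le_var _ int i l; rewrite nli.
Qed.

Lemma dfactor_sum omega i m :
  dfactor omega i m
  = \sum_(a < m) (that omega i + hvar k) ^+ (m.-1 - a) * tvar i ^+ a.
Proof. by rewrite /dfactor subrXX Pdiv.IdomainMonic.mulKp ?dfactor_divisor_monic. Qed.

(** In the geometric sum only the term [a = 0] lacks a factor [t_i]; it is the extra power. *)
Lemma dfactorS omega i m :
  dfactor omega i m.+1
  = tvar i * dfactor omega i m + (that omega i + hvar k) ^+ m.
Proof.
rewrite !dfactor_sum big_ord_recl subn0 mulr1 addrC; congr (_ + _).
rewrite mulr_sumr; apply: eq_bigr => a _ /=.
by rewrite /bump /= add1n exprS mulrCA; congr (_ * (_ ^+ _ * _)); lia.
Qed.

(** Each term of the geometric sum is a product of [m - 1] linear forms, each of degree at most 1 in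
    any given variable. *)
Lemma tdeg_le_dfactor i j omega m : tdeg_le i (m - 1) (dfactor omega j m).
Proof.
rewrite dfactor_sum; apply: tdeg_le_sum => a _.
have ha := ltn_ord a.
have h1 : tdeg_le i (1 * (m.-1 - a)) ((that omega j + hvar k) ^+ (m.-1 - a)).
  by apply: tdeg_le_exp; exact: tdeg_le_that.
have h2 : tdeg_le i (1 * a) (tvar j ^+ a).
  by apply: tdeg_le_exp; apply: tdeg_leW _ (@tdeg_le_var _ _ i j); case: (j == i).
by apply: tdeg_leW _ (tdeg_leM h1 h2); lia.
Qed.

(** Replaces function extensionality: [set_coord n i (n i)] is [n] only pointwise. *)
Lemma eq_d n n' delta omega : n =1 n' -> d n delta omega = d n' delta omega.
Proof.
move=> en; rewrite /d /dpoly.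
under eq_forallb do rewrite en.
under eq_bigr do rewrite en.
by case: ifP => // _; congr mcoeff; apply/mnmP => j; rewrite !mnmE en.
Qed.

Lemma dpoly_set_coord n omega i m :
  dpoly (set_coord n i m) omega
  = dfactor omega i m * \prod_(j < k | j != i) dfactor omega j (n j).
Proof.
rewrite /dpoly (bigD1 i) //= /set_coord eqxx; congr (_ * _).
by apply: eq_bigr => j /negPf ->.
Qed.

Lemma d_set_coordS n delta omega i m :
  omega i = 1%N -> (\sum_(j < k | j != i) (n j - 1) + delta i < m)%N ->
  d (set_coord n i m.+1) delta omega = d (set_coord n i m) delta omega.
Proof.
move=> omi ltm; rewrite /d.
(* Only the test at [i] could change, and there [delta i < m] makes it succeed on both sides. *)
have -> : [forall j, (delta j < set_coord n i m.+1 j)%N]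
        = [forall j, (delta j < set_coord n i m j)%N].
  apply: eq_forallb => j; rewrite /set_coord; case: eqP => // ->; lia.
case: ifP => // _.
set mS := [multinom _ | j < k]; set mm := [multinom _ | j < k].
(* As [delta i < m], the subtractions at [i] do not truncate, so the exponent really rises by
   one. *)
have mSE : mS = (mm + U_(i))%MM.
  apply/mnmP => j; rewrite mnmDE mnm1E !mnmE /set_coord (eq_sym i).
  by case: eqP => [->|_]; lia.
have lt : (0 * m + \sum_(j < k | j != i) (n j - 1) < mS i)%N.
  by rewrite mnmE /set_coord eqxx; lia.
have hs : tdeg_le i (0 * m) ((that omega i + hvar k) ^+ m).
  by apply: tdeg_le_exp; exact: tdeg_le_that_self.
have hQ : tdeg_le i (\sum_(j < k | j != i) (n j - 1))
    (\prod_(j < k | j != i) dfactor omega j (n j)).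
  by apply: tdeg_le_prod => j _; exact: tdeg_le_dfactor.
(* The summand with the power of [s + h] has too small a [t_i]-degree to reach [mS]; in the other
   one, the factor [t_i] absorbs [U_(i)]. *)
rewrite !dpoly_set_coord dfactorS mulrDl coefD mcoeffD (tdeg_leM hs hQ) // addr0.
by rewrite -mulrA coefCM mulrC mSE addmC mcoeffMX.
Qed.

End Factors.

Theorem proposition33 (k : nat) (hk : (1 <= k)%N)
    (omega delta : 'I_k -> nat) (i : 'I_k) (homega : omega i = 1%N)
    (n : 'I_k -> nat) (hn : forall j : 'I_k, (0 < n j)%N)
    (hni : (n i - 1 = \sum_(j < k | j != i) (n j - 1) + delta i)%N) :
  forall m : nat, (n i <= m)%N ->
    d (set_coord n i m) delta omega = d n delta omega.
Proof.
have n_i_gt0 := hn i.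
elim=> [|m IHm]; first by lia.
rewrite leq_eqVlt => /predU1P[<- | ltm].
  by apply: eq_d => j; rewrite /set_coord; case: eqP => [->|].
rewrite d_set_coordS ?IHm //.
(* The required bound reads [n i - 1 < m], which follows from [n i <= m] because [n i] is
   positive. *)
by rewrite -hni; lia.
Qed.
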